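(* Let $P_0=N_p(\mathbf 0,I)$, let $0\le\varepsilon<1/3$ and $\beta=\{\Phi^{-1}(3/4)\}^2$. The maximum asymptotic bias of the deepest scatter matrix $\hat\Gamma$ (known location $\mathbf 0$) over the $\varepsilon$-contamination neighborhood of $P_0$ is $$B(\hat\Gamma,\varepsilon,P_0)=\max\left\{\frac{1}{\sqrt\beta}\,\Phi^{-1}\!\left(\frac{3-\varepsilon}{4(1-\varepsilon)}\right),\ \frac{\sqrt\beta}{\Phi^{-1}\!\left(\frac{3-5\varepsilon}{4(1-\varepsilon)}\right)}\right\}.$$
   Context: $\Phi$ is the standard normal distribution function, $\mathcal{S}^{p-1}$ the unit sphere of $\mathbb{R}^p$, $\mathcal{E}$ the set of symmetric positive definite $p\times p$ real matrices. For a probability $P$ on $\mathbb{R}^p$, $\mathbf X\sim P$ and $\Gamma\in\mathcal{E}$, the scatter depth (known location $\mathbf 0$) is $$D_S(\Gamma,P)=\inf_{\mathbf u\in\mathcal{S}^{p-1}}\min\{P(|\mathbf u^t\mathbf X|^2\le \mathbf u^t\Gamma\mathbf u),\,P(|\mathbf u^t\mathbf X|^2\ge \mathbf u^t\Gamma\mathbf u)\},$$ and the deepest scatter matrix is $\hat\Gamma(P)=\arg\max_{\Gamma\in\mathcal{E}}D_S(\Gamma,P)$. At $P_0$ it is $\hat\Gamma(P_0)=\beta I$. The contamination neighborhood is $\mathcal{P}_\varepsilon(P_0)=\{(1-\varepsilon)P_0+\varepsilon G: G\text{ any distribution on }\mathbb{R}^p\}$. The explosion and implosion maximum biases are $$B_E(\hat\Gamma,\varepsilon,P_0)=\sup_{P\in\mathcal{P}_\varepsilon(P_0)}\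 \sup_{\mathbf u\in\mathcal{S}^{p-1}}\frac{\mathbf u^t\hat\Gamma(P)\mathbf u}{\mathbf u^t\hat\Gamma(P_0)\mathbf u},\qquad B_I(\hat\Gamma,\varepsilon,P_0)=\sup_{P\in\mathcal{P}_\varepsilon(P_0)}\ \sup_{\mathbf u\in\mathcal{S}^{p-1}}\frac{\mathbf u^t\hat\Gamma(P)^{-1}\mathbf u}{\mathbf u^t\hat\Gamma(P_0)^{-1}\mathbf u},$$ and $B(\hat\Gamma,\varepsilon,P_0)=\max\{B_E(\hat\Gamma,\varepsilon,P_0),B_I(\hat\Gamma,\varepsilon,P_0)\}$.
   Formalization: With B_E, B_I as ratios of quadratic forms, the printed maximum is the square root of B, so the formal theorem squares it; p ≥ 2 is assumed, since for p = 1 the formula fails; the argmax is a set, and the suprema run over all deepest matrices. *)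

(* Defs.v *)
From HB Require Import structures.
From mathcomp Require Import all_boot all_order all_algebra.
From mathcomp Require Import all_classical all_reals all_analysis.

Set Implicit Arguments.
Unset Strict Implicit.
Unset Printing Implicit Defensive.

Import Order.TTheory GRing.Theory Num.Theory.

Local Open Scope classical_set_scope.
Local Open Scope ring_scope.

(* R^p is [p.-tuple R]: its canonical sigma-algebra, generated by the
   coordinates, is the Borel one. Directions and matrices are in 'cV and 'M. *)
Section scatter.
Context {R : realType}.

(* u^t x *)
Definition dotp p (u : 'cV[R]_p) (x : p.-tuple R) : R :=
  \sum_(i < p) u i 0 * tnth x i.

(* u^t Gamma u *)
Definition qform p (Gamma : 'M[R]_p) (u : 'cV[R]_p) : R :=
  (u^T *m Gamma *m u) 0 0.

Definition usphere p : set 'cV[R]_p :=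
  [set u | \sum_(i < p) u i 0 ^+ 2 = 1].

Definition spd p : set 'M[R]_p :=
  [set Gamma | Gamma^T = Gamma /\ forall u, u != 0 -> 0 < qform Gamma u].

(* [normal_prob] lives on [measurableTypeR R], which has the same carrier and
   the same measurable sets as R but another display. *)
Definition tcons p (x : measurableTypeR R * p.-tuple R) : p.+1.-tuple R :=
  [the p.+1.-tuple R of (x.1 : R) :: x.2].

Lemma measurable_tcons p : measurable_fun setT (@tcons p).
Proof.
by apply: (@measurable_cons _ _ _ R (fun x => x.1 : R) p snd);
  [exact: measurable_fst|exact: measurable_snd].
Qed.

HB.instance Definition _ p :=
  isMeasurableFun.Build _ _ _ _ (@tcons p) (@measurable_tcons p).

(* N_p(0, I): the p-fold product of the standard normal law. *)
Fixpoint std_normal p : probability (p.-tuple R) R :=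
  match p return probability (p.-tuple R) R with
  | 0 => \d_ [tuple]
  | q.+1 =>
      distribution (normal_prob (0 : R) 1 \x std_normal q)%E (@tcons q)
  end.

Definition Phi (t : R) : R := fine (normal_prob (0 : R) 1 `]-oo, t]).

(* The inverse of Phi on ]0, 1[. *)
Definition Phi_inv (a : R) : R := inf [set t | a <= Phi t].

Definition scatter_depth p (Gamma : 'M[R]_p) (P : probability (p.-tuple R) R)
    : \bar R :=
  ereal_inf [set mine (P [set x | `|dotp u x| ^+ 2 <= qform Gamma u])
                      (P [set x | `|dotp u x| ^+ 2 >= qform Gamma u])
            | u in @usphere p].

(* The argmax is not unique in general, hence it is a set of matrices. *)
Definition deepest p (P : probability (p.-tuple R) R) : set 'M[R]_p :=
  [set Gamma | spd Gamma /\
    forall Gamma', spd Gamma' ->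
      (scatter_depth Gamma' P <= scatter_depth Gamma P)%E].

Definition contamination p (eps : R) (P0 : probability (p.-tuple R) R)
    : set (probability (p.-tuple R) R) :=
  [set P | exists G : probability (p.-tuple R) R, forall A, measurable A ->
    P A = ((1 - eps)%:E * P0 A + eps%:E * G A)%E].

(* Maximum biases of a scatter functional T whose values are sets of matrices:
   the suprema also range over the elements of T P and T P0. *)
Section maximum_bias.
Context {p : nat} (T : probability (p.-tuple R) R -> set 'M[R]_p).
Variables (eps : R) (P0 : probability (p.-tuple R) R).

Definition explosion_bias : \bar R :=
  ereal_sup [set b | exists P Gamma Gamma0,
    [/\ contamination eps P0 P, T P Gamma, T P0 Gamma0 &
        b = ereal_sup [set (qform Gamma u / qform Gamma0 u)%:E
                      | u in @usphere p]]].

Definition implosion_bias : \bar R :=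
  ereal_sup [set b | exists P Gamma Gamma0,
    [/\ contamination eps P0 P, T P Gamma, T P0 Gamma0 &
        b = ereal_sup [set (qform (invmx Gamma) u / qform (invmx Gamma0) u)%:E
                      | u in @usphere p]]].

Definition maximum_bias : \bar R := maxe explosion_bias implosion_bias.

End maximum_bias.

End scatter.

(* Main.v *)
Require Import Defs.
From HB Require Import structures.
From mathcomp Require Import all_boot all_order all_algebra.
From mathcomp Require Import all_classical all_reals all_analysis.
From mathcomp Require Import measurable_realfun.
From mathcomp Require Import ring lra.

(** The proof squeezes the scales u^t Gamma u of the deepest matrices between two
    bounds, and exhibits one contaminated law at which both are attained.

    Projections of N_p(0, I) on unit vectors are N(0, 1) ([dotp_normal_law]), so
    the P0-probability of the slab {|u^t x|^2 <= t} is 2 Phi(sqrt t) - 1. This is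
    1 / 2 at t = beta, whatever u. Hence, under P = (1 - eps) P0 + eps G, the matrix
    beta I has depth at least (1 - eps) / 2, and so has every deepest matrix Gamma.
    Since G adds at most eps to the probability of a slab or of its complement,
    the P0-probability of the slab of Gamma differs from 1 / 2 by at most
    eps / (1 - eps) in each direction. Inverting Phi turns this into
    [min_scale eps ^+ 2 <= u^t Gamma u <= max_scale eps ^+ 2] ([deepest_bounds]);
    for eps = 0 it shows that beta I is the only candidate at P0. The upper bounds on
    both biases follow, the one on inverses by [qform_invmx_le].

    For the lower bounds, G is a point mass at a point x of a coordinate axis. If x
    is far enough, no matrix has depth larger than (1 - eps) / 2
    ([point_mass_depth_le]): when the direction u turns away from the axis, x passes
    from the outside to the inside of the slab of Gamma, and at this moment the slab
    would have to be both wider and narrower than its median width. Therefore any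
    matrix of depth (1 - eps) / 2 is deepest. Such is the matrix
    with scale max_scale along the axis of x and min_scale orthogonally to it,
    provided that x enters the slab precisely in the directions where
    u^t Gamma u = beta ([extremal_deepest]). It attains the explosion and the
    implosion bounds simultaneously. A second axis is needed both to turn u and to
    observe the implosion, whence p >= 2. *)

Set Implicit Arguments.
Unset Strict Implicit.
Unset Printing Implicit Defensive.

Import Order.TTheory GRing.Theory Num.Theory.
Import numFieldNormedType.Exports.

Local Open Scope classical_set_scope.
Local Open Scope ring_scope.

(** * Linear images of the standard normal law *)

Section normal.
Context {R : realType}.
Notation mu := (@lebesgue_measure R).
Notation N := (normal_prob (0 : R) 1).
Local Open Scope charge_scope.

(** The density is a Radon-Nikodym derivative: integrals against the normal law
    become Lebesgue integrals, to which Tonelli applies below. *)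
Lemma integral_normal_prob (m s : R) (f : measurableTypeR R -> \bar R) :
  measurable_fun setT f ->
  (normal_prob m s).-integrable setT f ->
  (\int[normal_prob m s]_x f x = \int[mu]_x (f x * (normal_pdf m s x)%:E))%E.
Proof.
move=> mf fi.
rewrite -(Radon_Nikodym_change_of_variables (normal_prob_dominates m s))//=.
apply: ae_eq_integral => //=.
- apply: emeasurable_funM => //.
  apply: (measurable_int mu).
  by apply: Radon_Nikodym_integrable; exact: normal_prob_dominates.
- apply: emeasurable_funM => //.
  by apply/measurable_EFinP; exact: measurable_normal_pdf.
- apply: ae_eqe_mul2l => /=.
  rewrite Radon_NikodymE//=; first exact: normal_prob_dominates.
  move=> ?.
  case: cid => /= h [h1 h2 h3].
  apply: integral_ae_eq => //=.
  + by apply/measurable_EFinP; exact: measurable_normal_pdf.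
  + move=> E E01 mE.
    by have := h3 E mE; rewrite -h3//.
Qed.

Lemma normal_pdf_scale (m b x : R) : 0 < b ->
  normal_pdf m b x = normal_pdf 0 1 ((x - m) / b) * b^-1.
Proof.
move=> b0; rewrite !normal_pdfE ?gt_eqF// /normal_peak /normal_fun subr0.
rewrite expr1n mul1r -mulrnAr sqrtrM ?sqr_ge0// sqrtr_sqr gtr0_norm//.
rewrite invfM [RHS]mulrC mulrA; congr (_ * expR _).
by field; rewrite gt_eqF.
Qed.

(** Substituting x := (x - m) / b in the integral of the density. Rays are
    enough: only distribution functions are ever compared. *)
Lemma normal_prob_ray (m b t : R) : 0 < b ->
  normal_prob m b `]-oo, t] = N `]-oo, (t - m) / b].
Proof.
move=> b0; rewrite /normal_prob.
pose F (x : R^o) : R^o := (x - m) / b.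
have dF x : derivable F x 1 by [].
have F'E : F^`()%classic = cst b^-1.
  apply/funext => x; rewrite /F derive1E deriveM// deriveD// derive_cst scaler0.
  by rewrite add0r derive_id derive_cst addr0 scaler1.
have cF : continuous F.
  by move=> x; exact/differentiable_continuous/derivable1_diffP/dF.
have cN : continuous (normal_pdf (0 : R) 1).
  by apply: continuous_normal_pdf; exact: oner_neq0.
rewrite -/(F t) (@increasing_ge0_integration_by_substitutionNy _ F _ t).
- by apply: eq_integral => x _; rewrite F'E /= normal_pdf_scale.
- by move=> x y _ _ xy; rewrite /F ltr_pM2r ?invr_gt0// ltrD2r.
- by rewrite F'E => x _; exact: cvg_cst.
- by rewrite F'E; exact: is_cvg_cst.
- by rewrite F'E; exact: cvg_cst.
- split; first by move=> x _; exact: dF.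
  by apply: cvg_at_left_filter; exact: cF.
- apply/gt0_cvgMlNy; last exact: cvg_addrr_Ny.
  by rewrite invr_gt0.
- by apply: continuous_subspaceT.
- by move=> x _; exact: normal_pdf_ge0.
Qed.

(** The density is even. *)
Lemma normal_prob_ray_opp (t : R) : N `[t, +oo[ = N `]-oo, - t].
Proof.
have cN : continuous (normal_pdf (0 : R) 1).
  by apply: continuous_normal_pdf; exact: oner_neq0.
rewrite /normal_prob ge0_integration_by_substitutionNy.
- apply: eq_integral => x _ /=.
  by rewrite !normal_pdfE ?oner_eq0// /normal_fun !subr0 sqrrN.
- by apply: continuous_subspaceT.
- by move=> x _; exact: normal_pdf_ge0.
Qed.

(** Completing the square: the joint density of X and a X + b Y factors as the
    N(0, c^2) density of the sum times the conditional density of X, which is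
    normal in x and hence integrates to 1. *)
Lemma normal_pdf_prod (a b c x w : R) : 0 < b -> 0 < c ->
  c ^+ 2 = a ^+ 2 + b ^+ 2 ->
  normal_pdf 0 1 x * normal_pdf (a * x) b w =
  normal_pdf 0 c w * normal_pdf (a * w / c ^+ 2) (b / c) x.
Proof.
move=> b0 c0 cE.
have bc0 : 0 < b / c by rewrite divr_gt0.
rewrite (normal_pdf_scale (a * x) w b0) (normal_pdf_scale 0 w c0).
rewrite (normal_pdf_scale (a * w / c ^+ 2) x bc0) !normal_pdfE ?oner_eq0//.
rewrite /normal_fun !subr0.
set k := normal_peak 1.
rewrite [LHS](_ : _ = k * k * b^-1 * (expR (- x ^+ 2 / (1 ^+ 2 *+ 2)) *
   expR (- ((w - a * x) / b) ^+ 2 / (1 ^+ 2 *+ 2)))); last by ring.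
rewrite [RHS](_ : _ = k * k * b^-1 * (expR (- (w / c) ^+ 2 / (1 ^+ 2 *+ 2)) *
   expR (- ((x - a * w / c ^+ 2) / (b / c)) ^+ 2 / (1 ^+ 2 *+ 2)))); last first.
  by field; rewrite !gt_eqF.
congr (_ * _); rewrite -!expRD; congr expR.
have bn0 : b != 0 by rewrite gt_eqF.
have cn0 : c != 0 by rewrite gt_eqF.
transitivity (- (w ^+ 2 + x ^+ 2 * c ^+ 2 - 2 * a * x * w) / (2 * b ^+ 2)).
  by rewrite cE; field.
have e0 : a ^+ 2 + b ^+ 2 - c ^+ 2 = 0 by rewrite cE subrr.
transitivity (- (w ^+ 2 + x ^+ 2 * c ^+ 2 - 2 * a * x * w) / (2 * b ^+ 2) -
  (a ^+ 2 + b ^+ 2 - c ^+ 2) * w ^+ 2 / (2 * b ^+ 2 * c ^+ 2)).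
  by rewrite e0 !mul0r subr0.
by field; rewrite bn0 cn0.
Qed.

Lemma measurable_normal_pdf2 (a b : R) : 0 < b ->
  measurable_fun setT
   (fun z : measurableTypeR R * measurableTypeR R => normal_pdf (a * z.1) b z.2).
Proof.
move=> b0.
apply: (eq_measurable_fun
  (fun z : measurableTypeR R * measurableTypeR R =>
     normal_pdf 0 1 ((z.2 - a * z.1) / b) * b^-1)).
  by move=> z _; rewrite -normal_pdf_scale.
apply: measurable_funM => //.
apply: measurableT_comp; first exact: measurable_normal_pdf.
apply: measurable_funM => //; apply: measurable_funB => //.
by apply: measurable_funM.
Qed.

(** For independent X, Y ~ N(0, 1), conditioning on X shows that a X + b Y has
    the distribution function of c X: Tonelli exchanges the integrals and the
    inner one is 1 by [normal_pdf_prod]. *)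
Lemma normal_convolution (a b c t : R) : 0 < b -> 0 < c ->
  c ^+ 2 = a ^+ 2 + b ^+ 2 ->
  (\int[N]_x N `]-oo, ((t - a * x) / b)%R] = N `]-oo, (t / c)%R])%E.
Proof.
move=> b0 c0 cE.
pose ind (w : measurableTypeR R) : R := \1_(`]-oo, t]%classic : set R) w.
have mind : measurable_fun setT ind by exact: measurable_indic.
have ray m s : 0 < s -> (normal_prob m s `]-oo, t] =
    \int[mu]_w (normal_pdf m s w * ind w)%:E)%E.
  move=> s0; rewrite /normal_prob integral_mkcond; apply: eq_integral => w _.
  by rewrite restrict_EFin patch_indic.
pose g (z : measurableTypeR R * measurableTypeR R) : R :=
  normal_pdf (a * z.1) b z.2 * ind z.2.
have mg : measurable_fun setT g.
  apply: measurable_funM; first exact: measurable_normal_pdf2.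
  exact: measurableT_comp.
have g0 z : 0 <= g z by rewrite mulr_ge0// ?normal_pdf_ge0.
have sliceE x : (N `]-oo, ((t - a * x) / b)%R] = \int[mu]_w (g (x, w))%:E)%E.
  by rewrite -normal_prob_ray// ray.
have mslice : measurable_fun setT
    (fun x : measurableTypeR R => \int[mu]_w (g (x, w))%:E)%E.
  apply: (measurable_fun_fubini_tonelli_F (fun z => (g z)%:E)) => //.
  by apply/measurable_EFinP.
under eq_integral do rewrite sliceE.
rewrite integral_normal_prob//; last first.
  apply: (le_integrable measurableT _ _
    (finite_measure_integrable_cst N 1%R measurableT)) => // x _.
  rewrite -sliceE gee0_abs ?measure_ge0// /= normr1.
  by apply: (@probability_le1 _ _ _ (N : probability _ _)).
transitivity (\int[mu]_x \int[mu]_w (normal_pdf 0 1 x * g (x, w))%:E)%E.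
  apply: eq_integral => x _; rewrite muleC -ge0_integralZl//.
  - apply/measurable_EFinP; apply: measurableT_comp => //.
  - by move=> w _; rewrite lee_fin.
  - by rewrite lee_fin normal_pdf_ge0.
rewrite (fubini_tonelli (fun z : measurableTypeR R * measurableTypeR R =>
   (normal_pdf 0 1 z.1 * g z)%:E))/=; last 2 first.
- apply/measurable_EFinP; apply: measurable_funM => //.
  by apply: measurableT_comp => //; exact: measurable_normal_pdf.
- by move=> z; rewrite lee_fin mulr_ge0// normal_pdf_ge0.
rewrite -[t in RHS]subr0 -normal_prob_ray// ray//; apply: eq_integral => w _.
transitivity (\int[mu]_x ((normal_pdf (a * w / c ^+ 2) (b / c) x)%:E *
    (normal_pdf 0 c w * ind w)%:E))%E.
  apply: eq_integral => x _; rewrite -EFinM /g/= mulrA.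
  by rewrite (normal_pdf_prod _ _ b0 c0 cE) mulrAC mulrC.
rewrite ge0_integralZr//.
- by rewrite integral_normal_pdf mul1e.
- by apply/measurable_EFinP; exact: measurable_normal_pdf.
- by move=> x _; rewrite lee_fin normal_pdf_ge0.
- by rewrite lee_fin mulr_ge0// normal_pdf_ge0.
Qed.

Lemma dotp_tcons p (u : 'cV[R]_p.+1) (x : R) (y : p.-tuple R) :
  dotp u (tcons (x, y)) =
  u ord0 0 * x + dotp (\col_i u (lift ord0 i) 0) y.
Proof.
rewrite /dotp big_ord_recl /= tnth0; congr (_ + _).
by apply: eq_bigr => i _; rewrite mxE tnthS.
Qed.

Lemma measurable_dotp p (u : 'cV[R]_p) : measurable_fun setT (dotp u).
Proof.
apply: measurable_sum => i; apply: measurable_funM => //.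
exact: measurable_tnth.
Qed.

Definition sqnorm p (u : 'cV[R]_p) : R := \sum_(i < p) u i 0 ^+ 2.

Lemma sqnorm_ge0 p (u : 'cV[R]_p) : 0 <= sqnorm u.
Proof. by apply: sumr_ge0 => i _; rewrite sqr_ge0. Qed.

Lemma normal_prob_half_line (s t : R) : 0 < s ->
  N [set z | s * z <= t] = N `]-oo, t / s].
Proof.
move=> s0; congr normal_prob; apply/seteqP; split => z /=;
  by rewrite in_itv/= ler_pdivlMr// mulrC.
Qed.

Lemma normal_prob_half_line_norm (s t : R) :
  N [set z | s * z <= t] = N [set z | `|s| * z <= t].
Proof.
have [s0|s0] := leP 0 s; first by rewrite ger0_norm.
rewrite ltr0_norm// [RHS]normal_prob_half_line ?oppr_gt0//.
rewrite invrN mulrN -normal_prob_ray_opp.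
congr normal_prob; apply/seteqP; split => z /=;
  by rewrite in_itv/= andbT ler_ndivrMr// mulrC.
Qed.

(** The projection of N_p(0, I) on u is N(0, |u|^2), by induction on p: one
    coordinate is added to an independent projection of the others. Writing the
    law as the image of N(0, 1) by scaling, instead of as [normal_prob 0 |u|],
    keeps the degenerate case |u| = 0 inside the statement. *)
Lemma dotp_normal_law p (u : 'cV[R]_p) (t : R) :
  std_normal p [set x | dotp u x <= t] =
  N [set z | Num.sqrt (sqnorm u) * z <= t].
Proof.
elim: p u t => [|p IH] u t.
  rewrite /sqnorm big_ord0 sqrtr0 /= diracE.
  have [t0|t0] := leP 0 t.
    rewrite mem_set /=; last by rewrite /= /dotp big_ord0.
    rewrite (_ : [set z | 0 * z <= t] = setT); last first.
      by apply/seteqP; split => // z _ /=; rewrite mul0r.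
    by rewrite probability_setT.
  rewrite memNset /=; last by rewrite /= /dotp big_ord0; apply/negP; rewrite -ltNge.
  rewrite (_ : [set z | 0 * z <= t] = set0) ?measure0//.
  by apply/seteqP; split => // z /=; rewrite mul0r leNgt t0.
set v : 'cV[R]_p := \col_i u (lift ord0 i) 0.
have -> : sqnorm u = u ord0 0 ^+ 2 + sqnorm v.
  rewrite /sqnorm big_ord_recl; congr (_ + _).
  by apply: eq_bigr => i _; rewrite mxE.
set a := u ord0 0.
transitivity (\int[N]_x N [set z | (Num.sqrt (sqnorm v) * z <= t - a * x)%R])%E.
  rewrite /= /pushforward /product_measure1; apply: eq_integral => x _.
  rewrite -IH /=; congr (std_normal p _).
  rewrite xsectionE.
  by apply/seteqP; split => y /=; rewrite dotp_tcons -/v -/a lerBrDl.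
have [r0|r0] := eqVneq (Num.sqrt (sqnorm v)) 0.
  have v0 : sqnorm v = 0.
    by apply/eqP; rewrite eq_le sqnorm_ge0 -sqrtr_eq0 r0 eqxx.
  rewrite v0 addr0 sqrtr_sqr -normal_prob_half_line_norm sqrtr0.
  have mA : measurable [set z : measurableTypeR R | a * z <= t].
    have ma : measurable_fun setT (fun z : measurableTypeR R => a * z).
      by apply: measurable_funM.
    rewrite -[X in measurable X]setTI.
    exact: (measurable_fun_le measurableT ma (measurable_cst t)).
  rewrite -[X in normal_prob _ _ X]setIT.
  rewrite -(@integral_indic _ _ _ N setT measurableT _ mA).
  apply: eq_integral => x _; rewrite indicE.
  have [xt|xt] := leP (a * x) t.
    rewrite mem_set//= (_ : [set z | _] = setT) ?probability_setT//.
    by apply/seteqP; split => // z _ /=; rewrite mul0r subr_ge0.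
  rewrite memNset/=; last by apply/negP; rewrite -ltNge.
  rewrite (_ : [set z | _] = set0) ?measure0//.
  by apply/seteqP; split => // z /=; rewrite mul0r subr_ge0 leNgt xt.
have {}r0 : 0 < Num.sqrt (sqnorm v) by rewrite lt_neqAle eq_sym r0 sqrtr_ge0.
have c0 : 0 < Num.sqrt (a ^+ 2 + sqnorm v).
  by rewrite sqrtr_gt0 ltr_wpDl ?sqr_ge0// -sqrtr_gt0.
rewrite normal_prob_half_line//.
under eq_integral do rewrite normal_prob_half_line//.
apply: normal_convolution => //.
by rewrite !sqr_sqrtr// ?sqnorm_ge0// addr_ge0 ?sqr_ge0 ?sqnorm_ge0.
Qed.

End normal.

(** * The standard normal distribution function *)

Section Phi.
Context {R : realType}.
Notation mu := (@lebesgue_measure R).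
Notation N := (normal_prob (0 : R) 1).

Lemma PhiE (t : R) : N `]-oo, t] = (Phi t)%:E.
Proof. by rewrite /Phi fineK// fin_num_measure. Qed.

Lemma Phi_itv (x y : R) : x <= y -> N `]x, y] = (Phi y - Phi x)%:E.
Proof.
move=> xy; rewrite EFinB -!PhiE.
have -> : `]x, y]%classic = `]-oo, y] `\` `]-oo, x] :> set (measurableTypeR R).
  apply/seteqP; split => z /=; rewrite !in_itv/=.
    by move=> /andP[xz zy]; split => //; apply/negP; rewrite -ltNge.
  by move=> [-> /negP]; rewrite -ltNge => ->.
rewrite measureD//=; last by rewrite PhiE ltry.
congr (_ - N _)%E; apply/setIidr => z /=; rewrite !in_itv/=.
by move=> /le_trans; apply.
Qed.

(** Symmetry, together with the absence of atoms. *)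
Lemma PhiN (t : R) : Phi (- t) = 1 - Phi t.
Proof.
apply: EFin_inj; rewrite EFinB -!PhiE -normal_prob_ray_opp.
have -> : `[t, +oo[%classic = ~` `]-oo, t[ :> set (measurableTypeR R).
  by rewrite setCitvl.
rewrite probability_setC//; congr (_ - _)%E.
have -> : `]-oo, t]%classic = `]-oo, t[ `|` [set t] :> set (measurableTypeR R).
  by rewrite -(@setUitv1 _ _ _ _ true).
rewrite measureU//=; last first.
  by apply/seteqP; split => // z [/=]; rewrite in_itv/= => /[swap] ->; rewrite ltxx.
suff -> : N [set t] = 0%E by rewrite adde0.
have := @normal_prob_dominates R 0 1.
move=> /null_content_dominatesP; apply => //.
exact: lebesgue_measure_set1.
Qed.

Let peak : R := normal_peak 1.

Let peak_gt0 : 0 < peak. Proof. by apply: normal_peak_gt0; exact: oner_neq0. Qed.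

(** The density is bounded by its value at 0; this gives continuity. *)
Lemma Phi_lipschitz (x y : R) : x <= y -> Phi y - Phi x <= peak * (y - x).
Proof.
move=> xy; rewrite -lee_fin -Phi_itv// /normal_prob.
apply: (@le_trans _ _ (\int[mu]_(z in `]x, y]) peak%:E)%E).
  apply: ge0_le_integral => //=.
  - by move=> z _; rewrite lee_fin normal_pdf_ge0.
  - by apply/measurable_EFinP; apply: measurable_funTS; exact: measurable_normal_pdf.
  - by move=> z _; rewrite lee_fin; exact: normal_pdf_ub (oner_neq0 _).
rewrite integral_cst//= lebesgue_measure_itv/= lte_fin.
have [yx|xy'] := leP y x; first by rewrite mule0 lee_fin mulr_ge0 ?subr_ge0// ltW.
by rewrite -EFinD EFinM.
Qed.

(** On ]x, y] the density is bounded below by its value at |x| + |y|, which is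
    positive. *)
Lemma Phi_lt (x y : R) : x < y -> Phi x < Phi y.
Proof.
move=> xy; rewrite -subr_gt0 -lte_fin -Phi_itv ?ltW// /normal_prob.
pose M := `|x| + `|y|.
pose d := peak * expR (- M ^+ 2 / (1 ^+ 2 *+ 2)).
have d0 : 0 < d by rewrite mulr_gt0// expR_gt0.
apply: (@lt_le_trans _ _ (\int[mu]_(z in `]x, y]) d%:E)%E).
  rewrite integral_cst//= lebesgue_measure_itv/= lte_fin xy -EFinD -EFinM lte_fin.
  by rewrite mulr_gt0// subr_gt0.
apply: ge0_le_integral => //=.
- by move=> z _; rewrite lee_fin ltW.
- by apply/measurable_EFinP; apply: measurable_funTS; exact: measurable_normal_pdf.
move=> z; rewrite in_itv/= => /andP[xz zy].
rewrite lee_fin normal_pdfE ?oner_eq0// ler_pM2l// /normal_fun subr0 ler_expR.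
rewrite ler_pM2r ?invr_gt0 ?mulrn_wgt0 ?exprn_gt0// lerN2.
rewrite -(real_normK (num_real z)) lerXn2r ?nnegrE ?addr_ge0//.
rewrite ler_norml /M; have := ler_norm y; have := ler_norm (- x); rewrite normrN.
have := normr_ge0 x; have := normr_ge0 y; lra.
Qed.

Lemma Phi_le : {mono (@Phi R) : x y / x <= y}.
Proof. exact: le_mono Phi_lt. Qed.

Lemma Phi_continuous : continuous (@Phi R).
Proof.
move=> x; apply/cvgrPdist_le => e e0.
near=> y.
have yx : `|x - y| <= e / peak.
  by near: y; apply: cvgr_dist_le; [exact: cvg_id|rewrite divr_gt0].
suff : `|Phi x - Phi y| <= peak * `|x - y|.
  by move=> /le_trans; apply; rewrite mulrC -ler_pdivlMr.
have [xy|/ltW xy] := leP x y.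
  rewrite distrC (distrC x) !ger0_norm ?subr_ge0 ?Phi_le//.
  exact: Phi_lipschitz.
rewrite !ger0_norm ?subr_ge0 ?Phi_le//.
exact: Phi_lipschitz.
Unshelve. all: by end_near. Qed.

Lemma Phi_exceeds (a : R) : a < 1 -> exists t, a < Phi t.
Proof.
move=> a1.
have : N `]-oo, n%:R] @[n --> \oo] --> N setT.
  have -> : [set: measurableTypeR R] = \bigcup_n `]-oo, n%:R]%classic.
    apply/seteqP; split => // t _.
    by exists (Num.truncn t).+1; rewrite //= in_itv/= ltW// truncnS_gt.
  apply: nondecreasing_cvg_mu => //; first exact: bigcup_measurable.
  move=> n m nm; apply/subsetPset => x/=; rewrite !in_itv/= => /le_trans.
  by apply; rewrite ler_nat.
rewrite (probability_setT N) => cvgN.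
have a1E : (a%:E < 1)%E by rewrite lte_fin.
have [n _ /(_ n (leqnn n)) /=] := cvgN _ (open_ereal_gt' a1E).
by rewrite PhiE lte_fin => an; exists n%:R.
Qed.

(** Intermediate values; the lower tail is reached from the upper one by
    [PhiN]. *)
Lemma Phi_surj (a : R) : 0 < a < 1 -> exists t, Phi t = a.
Proof.
move=> /andP[a0 a1].
have [t at_] := Phi_exceeds a1.
have [s as_] : exists s, Phi s < a.
  have [|s hs] := @Phi_exceeds (1 - a); first lra.
  by exists (- s); rewrite PhiN; lra.
have st : s <= t by rewrite -Phi_le; lra.
have [|//|x _ xa] := @IVT R Phi s t a st.
- by apply: continuous_subspaceT; exact: Phi_continuous.
- by rewrite (min_idPl _) ?(max_idPr _)// ?Phi_le//; lra.
by exists x.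
Qed.

Lemma Phi_invK (a : R) : 0 < a < 1 -> Phi (Phi_inv a) = a.
Proof.
move=> /Phi_surj[t <-]; congr Phi; rewrite /Phi_inv.
rewrite (_ : [set x | _] = `[t, +oo[%classic) ?inf_itv//.
by apply/seteqP; split => x /=; rewrite in_itv/= andbT Phi_le.
Qed.

Lemma Phi0 : Phi (0 : R) = 1 / 2.
Proof. by have := PhiN 0; rewrite oppr0; lra. Qed.

Lemma Phi_inv_gt0 (a : R) : 1 / 2 < a -> a < 1 -> 0 < Phi_inv a.
Proof.
move=> a0 a1; rewrite -(leW_mono Phi_le) Phi0 Phi_invK//; lra.
Qed.

End Phi.

(** * Laws of squared projections, contamination and depth *)

Section law.
Context {R : realType}.

Lemma dotpN p (u : 'cV[R]_p) x : dotp (- u) x = - dotp u x.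
Proof. by rewrite /dotp -sumrN; apply: eq_bigr => i _; rewrite mxE mulNr. Qed.

Lemma usphereN p (u : 'cV[R]_p) : usphere u -> usphere (- u).
Proof.
by rewrite /usphere/= => <-; apply: eq_bigr => i _; rewrite mxE sqrrN.
Qed.

Lemma dotp_law p (u : 'cV[R]_p) t : usphere u ->
  std_normal p [set x | dotp u x <= t] = (Phi t)%:E.
Proof.
move=> u1; rewrite dotp_normal_law /sqnorm u1 sqrtr1.
by rewrite normal_prob_half_line// divr1 PhiE.
Qed.

Lemma measurable_dotp_le p (u : 'cV[R]_p) t :
  measurable [set x | dotp u x <= t].
Proof.
rewrite -[X in measurable X]setTI.
exact: (measurable_fun_le measurableT (measurable_dotp u) (measurable_cst t)).
Qed.

Let sqr_le (a q : R) : 0 < q -> (`|a| ^+ 2 <= q) = (- Num.sqrt q <= a <= Num.sqrt q).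
Proof.
move=> q0; rewrite -ler_norml -[in LHS](sqr_sqrtr (ltW q0)).
by rewrite ler_pXn2r ?nnegrE ?sqrtr_ge0.
Qed.

Let sqr_ge (a q : R) : 0 < q -> (q <= `|a| ^+ 2) = (Num.sqrt q <= `|a|).
Proof.
move=> q0; rewrite -[in LHS](sqr_sqrtr (ltW q0)).
by rewrite ler_pXn2r ?nnegrE ?sqrtr_ge0.
Qed.

Lemma measurable_sqdotp_le p (u : 'cV[R]_p) (q : R) :
  measurable [set x | `|dotp u x| ^+ 2 <= q].
Proof.
have mf : measurable_fun setT (fun x => `|dotp u x| ^+ 2).
  by apply: measurable_funX; apply: measurableT_comp => //; exact: measurable_dotp.
rewrite -[X in measurable X]setTI.
exact: (measurable_fun_le measurableT mf (measurable_cst q)).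
Qed.

Lemma measurable_sqdotp_ge p (u : 'cV[R]_p) (q : R) :
  measurable [set x | `|dotp u x| ^+ 2 >= q].
Proof.
have mf : measurable_fun setT (fun x => `|dotp u x| ^+ 2).
  by apply: measurable_funX; apply: measurableT_comp => //; exact: measurable_dotp.
rewrite -[X in measurable X]setTI.
exact: (measurable_fun_le measurableT (measurable_cst q) mf).
Qed.

(** Both tails are expressed with half-spaces {u^t x <= s}, the left one through
    the direction - u, since these are the sets whose probability is known. *)
Lemma sqdotp_law_le p (u : 'cV[R]_p) (q : R) : usphere u -> 0 < q ->
  std_normal p [set x | `|dotp u x| ^+ 2 <= q] = (2 * Phi (Num.sqrt q) - 1)%:E.
Proof.
move=> u1 q0; set s := Num.sqrt q.
have mlow := measurable_dotp_le (- u) s.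
have -> : [set x | `|dotp u x| ^+ 2 <= q] =
    [set x | dotp u x <= s] `\` ~` [set x | dotp (- u) x <= s].
  apply/seteqP; split => x /=; rewrite sqr_le// dotpN lerNl -/s.
    by move=> /andP[-> ->]; split => //; exact/contrapT.
  by move=> [-> /contrapT ->].
rewrite measureD//; [|exact: measurable_dotp_le|exact: measurableC|]; last first.
  by rewrite -ge0_fin_numE// fin_num_measure//; exact: measurable_dotp_le.
rewrite (_ : _ `&` _ = ~` [set x | dotp (- u) x <= s]); last first.
  apply/setIidr => x /= /negP; rewrite dotpN -ltNge ltrNr => h.
  have := sqrtr_ge0 q; rewrite -/s; lra.
rewrite [X in (_ - X)%E]probability_setC// !dotp_law//; last exact: usphereN.
rewrite [X in (X - _)%E](_ : _ = (Phi s)%:E); last exact: dotp_law.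
by rewrite -!EFinB; congr EFin; ring.
Qed.

Lemma sqdotp_law_ge p (u : 'cV[R]_p) (q : R) : usphere u -> 0 < q ->
  std_normal p [set x | `|dotp u x| ^+ 2 >= q] = (2 - 2 * Phi (Num.sqrt q))%:E.
Proof.
move=> u1 q0; have s0 : 0 < Num.sqrt q by rewrite sqrtr_gt0.
set s := Num.sqrt q in s0 *.
have -> : [set x | `|dotp u x| ^+ 2 >= q] =
    [set x | dotp u x <= - s] `|` [set x | dotp (- u) x <= - s].
  apply/seteqP; split => x /=; rewrite sqr_ge// dotpN -/s ler_normr.
    by move=> /orP[|]; [right|left]; lra.
  by move=> [h|h]; apply/orP; [right|left]; lra.
rewrite measureU//; try exact: measurable_dotp_le; last first.
  by apply/seteqP; split => // x [/=]; rewrite dotpN; lra.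
rewrite [X in (X + _)%E](_ : _ = (Phi (- s))%:E); last exact: dotp_law.
rewrite [X in (_ + X)%E](_ : _ = (Phi (- s))%:E); last first.
  by apply: dotp_law; exact: usphereN.
by rewrite -!EFinD PhiN; congr EFin; ring.
Qed.

End law.

Section mixture.
Context d (T : measurableType d) (R : realType).
Variables (eps : R) (P Q : probability T R).
Hypotheses (eps0 : 0 <= eps) (eps1 : eps <= 1).

Let a : {nonneg R} := NngNum eps0.
Let b : {nonneg R} := NngNum (etrans (subr_ge0 _ _) eps1).

(** Contaminated laws are only characterised by their values; this is the law
    itself, with its probability structure. *)
Definition mixture := measure_add (mscale b P) (mscale a Q).

HB.instance Definition _ := Measure.on mixture.

Lemma mixtureE A : mixture A = ((1 - eps)%:E * P A + eps%:E * Q A)%E.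
Proof. by rewrite /mixture measure_addE. Qed.

Let mixture_setT : mixture setT = 1%E.
Proof. by rewrite mixtureE !probability_setT !mule1 -EFinD subrK. Qed.

HB.instance Definition _ :=
  @Measure_isProbability.Build _ _ R mixture mixture_setT.

End mixture.

Section depth.
Context {R : realType} {p : nat}.
Implicit Types (P : probability (p.-tuple R) R) (Gamma : 'M[R]_p).

Lemma le_scatter_depth P Gamma (c : \bar R) :
  (forall u, usphere u ->
     (c <= P [set x | (`|dotp u x| ^+ 2 <= qform Gamma u)%R])%E /\
     (c <= P [set x | (`|dotp u x| ^+ 2 >= qform Gamma u)%R])%E) ->
  (c <= scatter_depth Gamma P)%E.
Proof.
move=> h; apply: le_ereal_inf_tmp => _ [u u1 <-].
by rewrite le_min; apply/andP; exact: h.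
Qed.

Lemma scatter_depth_le P Gamma u : usphere u ->
  (scatter_depth Gamma P <= P [set x | (`|dotp u x| ^+ 2 <= qform Gamma u)%R])%E /\
  (scatter_depth Gamma P <= P [set x | (`|dotp u x| ^+ 2 >= qform Gamma u)%R])%E.
Proof.
move=> u1; apply/andP; rewrite -le_min; apply: ge_ereal_inf.
eexists; first by exists u.
exact: lexx.
Qed.

(** A direction sees the contaminating law only through two numbers of
    [0, 1]. *)
Lemma contaminated_law (eps : R) P u q : usphere u -> 0 < q ->
  0 <= eps -> contamination eps (std_normal p) P ->
  exists g h : R, [/\ 0 <= g <= 1, 0 <= h <= 1,
    P [set x | `|dotp u x| ^+ 2 <= q] =
      ((1 - eps) * (2 * Phi (Num.sqrt q) - 1) + eps * g)%:E &
    P [set x | `|dotp u x| ^+ 2 >= q] =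
      ((1 - eps) * (2 - 2 * Phi (Num.sqrt q)) + eps * h)%:E].
Proof.
move=> u1 q0 eps0 [G PE].
have GE A : measurable A -> exists2 g, 0 <= g <= 1 & G A = g%:E.
  move=> mA; exists (fine (G A)).
    rewrite fine_ge0//= -lee_fin fineK ?fin_num_measure//.
    exact: probability_le1.
  by rewrite fineK ?fin_num_measure.
have [g g01 gE] := GE _ (measurable_sqdotp_le u q).
have [h h01 hE] := GE _ (measurable_sqdotp_ge u q).
exists g, h; split => //.
  by rewrite PE ?gE ?sqdotp_law_le//; exact: measurable_sqdotp_le.
by rewrite PE ?hE ?sqdotp_law_ge//; exact: measurable_sqdotp_ge.
Qed.

End depth.

(** * Quadratic forms on the sphere *)

Section quadratic_forms.
Context {R : realType} {p : nat}.
Implicit Types (A : 'M[R]_p) (u v : 'cV[R]_p).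

Lemma sqnormE u : sqnorm u = (u^T *m u) 0 0.
Proof. by rewrite mxE; apply: eq_bigr => i _; rewrite mxE expr2. Qed.

Lemma qform_scalar (c : R) u : qform c%:M u = c * sqnorm u.
Proof. by rewrite /qform mul_mx_scalar -scalemxAl mxE sqnormE. Qed.

Lemma qformB A B u : qform (A - B) u = qform A u - qform B u.
Proof. by rewrite /qform mulmxBr mulmxBl !mxE. Qed.

Lemma qformZ A (k : R) u : qform A (k *: u) = k ^+ 2 * qform A u.
Proof.
by rewrite /qform -scalemxAr linearZ /= -!scalemxAl !mxE mulrA expr2.
Qed.

Lemma sqnormZ (k : R) u : sqnorm (k *: u) = k ^+ 2 * sqnorm u.
Proof. by rewrite -[sqnorm u]mul1r -[sqnorm (_ *: _)]mul1r -!qform_scalar qformZ. Qed.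

Lemma sqnorm_gt0 u : u != 0 -> 0 < sqnorm u.
Proof.
move=> u0; rewrite lt_neqAle sqnorm_ge0 andbT eq_sym.
apply: contraNneq u0 => /eqP; rewrite psumr_eq0; last by move=> i _; rewrite sqr_ge0.
move=> /allP u0; apply/eqP/colP => i; rewrite mxE; apply/eqP.
by rewrite -sqrf_eq0; exact: (implyP (u0 i (mem_index_enum _))).
Qed.

(** Homogeneity: the normalisation v of u serves all matrices at once, so that
    several forms can be compared along the same direction. *)
Lemma qform_sphere u : u != 0 -> exists2 v, usphere v & 
  forall A, qform A u = sqnorm u * qform A v.
Proof.
move=> u0; have n0 := sqnorm_gt0 u0.
have s0 : 0 < Num.sqrt (sqnorm u) by rewrite sqrtr_gt0.
exists ((Num.sqrt (sqnorm u))^-1 *: u).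
  have := sqnormZ (Num.sqrt (sqnorm u))^-1 u.
  by rewrite exprVn sqr_sqrtr ?ltW// mulVf ?gt_eqF.
by move=> A; rewrite qformZ exprVn sqr_sqrtr ?ltW// mulVKf ?gt_eqF.
Qed.

Lemma usphere_neq0 u : usphere u -> u != 0.
Proof.
move=> u1; apply/eqP => u0; move: u1; rewrite u0 /usphere /=.
by rewrite big1 => [/eqP|i _]; rewrite ?mxE ?expr0n// eq_sym oner_eq0.
Qed.

Lemma spd_gt0 A u : spd A -> usphere u -> 0 < qform A u.
Proof. by move=> [_ A0] /usphere_neq0; exact: A0. Qed.

Lemma spd_scalar (c : R) : 0 < c -> spd (c%:M : 'M[R]_p).
Proof.
move=> c0; split; first by rewrite tr_scalar_mx.
by move=> u /sqnorm_gt0 u0; rewrite qform_scalar mulr_gt0.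
Qed.

Lemma spd_unitmx A : spd A -> A \in unitmx.
Proof.
move=> [AT A0]; apply: contraT => Au.
have : ~~ row_free A by rewrite row_free_unit.
rewrite -kermx_eq0 => /rowV0Pn[v /sub_kermxP vA v0].
have : v^T != 0 by rewrite -trmx0 (inj_eq trmx_inj).
by move=> /A0; rewrite /qform trmxK vA mul0mx mxE ltxx.
Qed.

(** Polarisation of A - c I, whose form vanishes. *)
Lemma qform_sphere_scalar A (c : R) : A^T = A ->
  (forall u, usphere u -> qform A u = c) -> A = c%:M.
Proof.
move=> AT Ac; apply/eqP; rewrite -subr_eq0; apply/eqP.
set B := A - c%:M.
have BT : B^T = B by rewrite linearB /= AT tr_scalar_mx.
have B0 u : qform B u = 0.
  have [->|u0] := eqVneq u 0; first by rewrite /qform trmx0 !mul0mx mxE.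
  have [v v1 ->] := qform_sphere u0.
  rewrite qformB Ac// qform_scalar [sqnorm v]v1; ring.
have Buv u v : (u^T *m B *m v) 0 0 = 0.
  have sym : (v^T *m B *m u) 0 0 = (u^T *m B *m v) 0 0.
    have -> : v^T *m B *m u = (u^T *m B *m v)^T.
      by rewrite !trmx_mul trmxK BT mulmxA.
    by rewrite mxE.
  have addE (M N : 'M[R]_1) : (M + N) 0 0 = M 0 0 + N 0 0 by rewrite mxE.
  have trD : (u + v)^T = u^T + v^T by rewrite linearD.
  have := B0 (u + v); rewrite /qform trD mulmxDr !mulmxDl !addE sym.
  have := B0 u; have := B0 v; rewrite /qform => -> ->; lra.
apply/matrixP => i j; rewrite [RHS]mxE.
have := Buv (delta_mx i 0) (delta_mx j 0).
by rewrite trmx_delta -rowE -colE [LHS]mxE [LHS]mxE.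
Qed.

(** With v = A^-1 u and q = u^t v = v^t A v, one has m |v|^2 <= q, and
    q^2 <= |v|^2 by the Cauchy-Schwarz inequality; hence m q^2 <= q. *)
Lemma qform_invmx_le A u (m : R) : 0 < m -> spd A ->
  (forall v, usphere v -> m <= qform A v) -> usphere u ->
  qform (invmx A) u <= m^-1.
Proof.
move=> m0 sA Am u1; have uA := spd_unitmx sA.
set v := invmx A *m u.
have Av : A *m v = u by rewrite /v mulKVmx.
set q := qform (invmx A) u.
have qE : q = (u^T *m v) 0 0 by rewrite /q /qform -mulmxA.
have qv : q = qform A v.
  rewrite qE /qform -mulmxA Av.
  have -> : u^T *m v = (v^T *m u)^T by rewrite trmx_mul trmxK.
  by rewrite mxE.
have nv : m * sqnorm v <= q.
  rewrite qv; have [->|v0] := eqVneq v 0.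
    by rewrite /qform trmx0 !mul0mx sqnormE !mulmx0 !mxE mulr0.
  have [w w1 ->] := qform_sphere v0.
  by rewrite mulrC ler_wpM2l ?sqnorm_ge0// Am.
(* Cauchy-Schwarz for the unit vector u, from 0 <= |v - q u|^2. *)
have cs : q ^+ 2 <= sqnorm v.
  have := sqnorm_ge0 (v - q *: u).
  have -> : sqnorm (v - q *: u) = sqnorm v - 2 * q * q + q ^+ 2 * sqnorm u.
    rewrite [in X in _ - 2 * _ * X]qE mxE /sqnorm mulr_sumr.
    rewrite [in RHS]mulr_sumr -sumrN -!big_split /=; apply: eq_bigr => i _.
    rewrite !mxE; ring.
  rewrite [sqnorm u]u1; lra.
have [q0|q0] := leP q 0; first by rewrite (le_trans q0)// invr_ge0 ltW.
rewrite -[leRHS]mul1r ler_pdivlMr//.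
have h : m * q ^+ 2 <= q by rewrite (le_trans _ nv)// ler_pM2l.
rewrite -(ler_pM2l q0) mulr1.
by have -> : q * (q * m) = m * q ^+ 2 by ring.
Qed.

Lemma qform_invmx_eigen A u (c : R) : A \in unitmx -> c != 0 ->
  A *m u = c *: u -> usphere u -> qform (invmx A) u = c^-1.
Proof.
move=> uA c0 Au u1.
have -> : qform (invmx A) u = (u^T *m (invmx A *m u)) 0 0 by rewrite mulmxA.
have -> : invmx A *m u = c^-1 *: u.
  by rewrite -[u in LHS](scalerK c0) -Au -scalemxAr mulKmx.
by rewrite -scalemxAr mxE -sqnormE [sqnorm u]u1 mulr1.
Qed.

Lemma qform_line A u v (s : R) : qform A (u + s *: v) =
  qform A u + ((u^T *m A *m v) 0 0 + (v^T *m A *m u) 0 0) * s +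
  qform A v * s ^+ 2.
Proof.
have addE (M N : 'M[R]_1) : (M + N) 0 0 = M 0 0 + N 0 0 by rewrite mxE.
have scaleE (k : R) (M : 'M[R]_1) : (k *: M) 0 0 = k * M 0 0 by rewrite mxE.
have trD : (u + s *: v)^T = u^T + s *: v^T by rewrite linearD linearZ.
rewrite /qform trD mulmxDr !mulmxDl -!scalemxAr -!scalemxAl !addE !scaleE.
ring.
Qed.

Lemma qform_delta (i : 'I_p) u : qform (delta_mx i i) u = u i 0 ^+ 2.
Proof.
rewrite /qform -(mul_delta_mx (0 : 'I_1)) mulmxA -mulmxA -rowE -colE.
by rewrite mxE big_ord1 !mxE expr2.
Qed.

Lemma sqnorm_delta (i : 'I_p) : sqnorm (delta_mx i 0 : 'cV[R]_p) = 1.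
Proof.
rewrite /sqnorm (bigD1 i)//= mxE !eqxx expr1n big1 ?addr0// => j /negbTE ji.
by rewrite mxE ji expr0n.
Qed.

End quadratic_forms.

Section crossing.
Context {R : realType}.

(** The parabola q(s) = A + B s + C s^2 starts below rho and opens upwards, so it
    crosses the level rho at its larger root s0. Just before s0 the first
    hypothesis bounds q from below, just after it the second bounds q from above,
    and both bounds pass to the limit at s0. *)
Lemma quadratic_crossing (A B C rho tau1 tau2 : R) : 0 < C -> A < rho ->
  (forall s, A + B * s + C * s ^+ 2 < rho ->
     tau1 * (1 + s ^+ 2) <= A + B * s + C * s ^+ 2) ->
  (forall s, rho < A + B * s + C * s ^+ 2 ->
     A + B * s + C * s ^+ 2 <= tau2 * (1 + s ^+ 2)) ->
  tau1 <= tau2.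
Proof.
move=> C0 Ar hlt hgt.
pose D := B ^+ 2 + 4 * C * (rho - A).
have D0 : 0 < D.
  by rewrite ltr_wpDl ?sqr_ge0// mulr_gt0 ?subr_gt0// mulr_gt0.
have sD : 0 < Num.sqrt D by rewrite sqrtr_gt0.
pose s0 := (- B + Num.sqrt D) / (2 * C).
pose s1 := (- B - Num.sqrt D) / (2 * C).
have C20 : 2 * C != 0 by rewrite mulf_neq0 ?gt_eqF.
have s10 : s1 < s0 by rewrite /s1 /s0 ltr_pM2r ?invr_gt0 ?mulr_gt0//; lra.
have fact s : A + B * s + C * s ^+ 2 - rho = C * ((s - s0) * (s - s1)).
  have sqD : Num.sqrt D ^+ 2 = B ^+ 2 + 4 * C * (rho - A) by rewrite sqr_sqrtr ?ltW.
  have -> : (s - s0) * (s - s1) =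
      s ^+ 2 + B * s / C + (B ^+ 2 - Num.sqrt D ^+ 2) / (4 * C ^+ 2).
    by rewrite /s0 /s1; field; rewrite gt_eqF.
  by rewrite sqD; field; rewrite gt_eqF.
have s0E : A + B * s0 + C * s0 ^+ 2 = rho.
  by apply/eqP; rewrite -subr_eq0 fact subrr mul0r mulr0.
have pos : 0 < 1 + s0 ^+ 2 by rewrite ltr_pwDl// sqr_ge0.
have cont tau : (fun s => tau * (1 + s ^+ 2) - (A + B * s + C * s ^+ 2)) s
    @[s --> s0] --> tau * (1 + s0 ^+ 2) - rho.
  rewrite -[X in _ - X]s0E.
  apply: cvgB.
    by apply: cvgMr; apply: cvgD; [exact: cvg_cst|exact: exprn_continuous].
  apply: cvgD.
    by apply: cvgD; [exact: cvg_cst|apply: cvgMr; exact: cvg_id].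
  by apply: cvgMr; exact: exprn_continuous.
rewrite -(ler_pM2r pos); apply: (@le_trans _ _ rho).
  rewrite -subr_le0; apply: (cvgr_to_le (cvg_at_left_filter (cont tau1))).
  near=> s; rewrite subr_le0 hlt// -subr_lt0 fact pmulr_rlt0// nmulr_rlt0 ?subr_lt0//.
  by rewrite subr_gt0; near: s; exact: nbhs_left_gt.
rewrite -subr_ge0; apply: (cvgr_to_ge (cvg_at_right_filter (cont tau2))).
near=> s; rewrite subr_ge0 hgt// -subr_gt0 fact !mulr_gt0// subr_gt0//.
exact: lt_trans s10 _.
Unshelve. all: by end_near. Qed.

End crossing.

(** * Scales allowed by the depth of a contaminated normal law *)

Section scales.
Context {R : realType}.
Implicit Types eps : R.

(** [base_scale] is the median of |Z| for Z ~ N(0, 1), so its square is beta.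
    [max_scale] and [min_scale] are the quantiles of |Z| of orders
    1 / 2 + eps / (1 - eps) and 1 / 2 - eps / (1 - eps); [deepest_bounds] shows that
    they bound the scales of the deepest matrices. *)
Definition base_scale : R := Phi_inv (3 / 4).
Definition max_scale eps : R := Phi_inv ((3 - eps) / (4 * (1 - eps))).
Definition min_scale eps : R := Phi_inv ((3 - 5 * eps) / (4 * (1 - eps))).

Lemma Phi_base_scale : Phi base_scale = 3 / 4.
Proof. by rewrite Phi_invK//; lra. Qed.

Lemma base_scale_gt0 : 0 < base_scale.
Proof. by apply: Phi_inv_gt0; lra. Qed.

Lemma max_scale0 : max_scale 0 = base_scale.
Proof. by rewrite /max_scale /base_scale !subr0 mulr1. Qed.

Lemma min_scale0 : min_scale 0 = base_scale.
Proof. by rewrite /min_scale /base_scale mulr0 !subr0 mulr1. Qed.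

Section eps.
Variable eps : R.
Hypotheses (eps0 : 0 <= eps) (eps1 : eps < 1 / 3).

Let d0 : 0 < 4 * (1 - eps). Proof. move: eps0 eps1; lra. Qed.

Lemma Phi_max_scale : Phi (max_scale eps) = (3 - eps) / (4 * (1 - eps)).
Proof.
by rewrite Phi_invK// ltr_pdivrMr// mul1r divr_gt0//=; move: eps0 eps1; lra.
Qed.

Lemma Phi_min_scale : Phi (min_scale eps) = (3 - 5 * eps) / (4 * (1 - eps)).
Proof.
by rewrite Phi_invK// ltr_pdivrMr// mul1r divr_gt0//=; move: eps0 eps1; lra.
Qed.

(** At [max_scale] the complement of the slab has probability (1 - eps) / 2 if it
    carries the whole contaminating mass; at [min_scale] this is true of the slab.
    The two scales are determined by these identities. *)
Lemma max_scaleE :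
  (1 - eps) * (2 - 2 * Phi (max_scale eps)) + eps = (1 - eps) / 2.
Proof. by rewrite Phi_max_scale; field; move: eps1; lra. Qed.

Lemma min_scaleE :
  (1 - eps) * (2 * Phi (min_scale eps) - 1) + eps = (1 - eps) / 2.
Proof. by rewrite Phi_min_scale; field; move: eps1; lra. Qed.

Lemma min_scale_gt0 : 0 < min_scale eps.
Proof.
apply: Phi_inv_gt0; first by rewrite ltr_pdivlMr//; move: eps1; lra.
by rewrite ltr_pdivrMr//; move: eps0; lra.
Qed.

Lemma min_scale_le_base : min_scale eps <= base_scale.
Proof.
rewrite -Phi_le Phi_min_scale Phi_base_scale.
by rewrite ler_pdivrMr//; move: eps0; lra.
Qed.

Lemma min_scale_lt_base : 0 < eps -> min_scale eps < base_scale.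
Proof.
move=> ?; rewrite -(leW_mono Phi_le) Phi_min_scale Phi_base_scale.
by rewrite ltr_pdivrMr//; lra.
Qed.

Lemma base_scale_le_max : base_scale <= max_scale eps.
Proof.
rewrite -Phi_le Phi_max_scale Phi_base_scale.
by rewrite ler_pdivlMr//; move: eps0; lra.
Qed.

Lemma max_scale_gt0 : 0 < max_scale eps.
Proof. exact: lt_le_trans base_scale_gt0 base_scale_le_max. Qed.

End eps.

Lemma ler_sqrtE (t q : R) : 0 <= t -> 0 <= q ->
  (t <= Num.sqrt q) = (t ^+ 2 <= q).
Proof.
by move=> t0 q0; rewrite -[in RHS](sqr_sqrtr q0) ler_pXn2r ?nnegrE ?sqrtr_ge0.
Qed.

Lemma sqrtr_leE (t q : R) : 0 <= t -> 0 <= q ->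
  (Num.sqrt q <= t) = (q <= t ^+ 2).
Proof.
by move=> t0 q0; rewrite -[in RHS](sqr_sqrtr q0) ler_pXn2r ?nnegrE ?sqrtr_ge0.
Qed.

End scales.

Section deepest_bounds.
Context {R : realType} {p : nat}.
Implicit Types (P : probability (p.-tuple R) R) (Gamma : 'M[R]_p).

(** The uncontaminated part of the law alone guarantees this depth. *)
Lemma base_scale_depth (eps : R) P : 0 <= eps -> eps < 1 / 3 ->
  contamination eps (std_normal p) P ->
  (((1 - eps) / 2)%:E <= scatter_depth ((@base_scale R ^+ 2)%:M : 'M[R]_p) P)%E.
Proof.
move=> e0 e1 cP; apply: le_scatter_depth => u u1.
have -> : qform (@base_scale R ^+ 2)%:M u = @base_scale R ^+ 2.
  by rewrite qform_scalar [sqnorm u]u1 mulr1.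
have m0 := @base_scale_gt0 R.
have [g [h [/andP[g0 _] /andP[h0 _] -> ->]]] :=
  contaminated_law u1 (exprn_gt0 2 m0) e0 cP.
rewrite sqrtr_sqr gtr0_norm// Phi_base_scale !lee_fin.
have eg := mulr_ge0 e0 g0; have eh := mulr_ge0 e0 h0; lra.
Qed.

(** A deepest matrix is at least as deep as the one of [base_scale_depth]; in the
    direction u, even the whole mass eps of the contamination must then bring the
    probability of the slab, and that of its complement, up to (1 - eps) / 2. *)
Lemma deepest_bounds (eps : R) P Gamma u : 0 <= eps -> eps < 1 / 3 ->
  contamination eps (std_normal p) P -> deepest P Gamma -> usphere u ->
  min_scale eps ^+ 2 <= qform Gamma u <= max_scale eps ^+ 2.
Proof.
move=> e0 e1 cP [sG dG] u1.
have q0 : 0 < qform Gamma u := spd_gt0 sG u1.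
have D := le_trans (base_scale_depth e0 e1 cP)
  (dG _ (spd_scalar (exprn_gt0 2 (@base_scale_gt0 R)))).
have [/(le_trans D) + /(le_trans D)] := scatter_depth_le P Gamma u1.
have [g [h [/andP[_ g1] /andP[_ h1] -> ->]]] := contaminated_law u1 q0 e0 cP.
rewrite !lee_fin => Dg Dh.
have [l0 h0 q0'] :=
  And3 (ltW (min_scale_gt0 e0 e1)) (ltW (max_scale_gt0 e0 e1)) (ltW q0).
rewrite -(ler_sqrtE l0 q0') -(sqrtr_leE h0 q0').
rewrite -(Phi_le (min_scale eps)) -(Phi_le (Num.sqrt _) (max_scale eps)).
have eg : eps * g <= eps by rewrite ler_piMr.
have eh : eps * h <= eps by rewrite ler_piMr.
have e1' : 0 < 1 - eps by lra.
have := max_scaleE e0 e1; have := min_scaleE e0 e1.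
move: (Phi (min_scale eps)) (Phi (max_scale eps)) (Phi _) Dg Dh => x y z Dg Dh lx hy.
by rewrite -(ler_pM2l e1' x) -(ler_pM2l e1' z); apply/andP; split; lra.
Qed.

(** For eps = 0 the two bounds coincide. *)
Lemma deepest_std_normal Gamma : deepest (std_normal p) Gamma ->
  Gamma = (@base_scale R ^+ 2)%:M.
Proof.
move=> dG; have [[GT _] _] := dG; apply: qform_sphere_scalar => // u u1.
have c0 : contamination (0 : R) (@std_normal R p) (@std_normal R p).
  by exists (std_normal p) => A mA; rewrite subr0 mul1e mul0e adde0.
have lt3 : (0 : R) < 1 / 3 by lra.
have := deepest_bounds (lexx 0) lt3 c0 dG u1.
by rewrite max_scale0 min_scale0 -eq_le => /eqP.
Qed.

End deepest_bounds.

(** * Contamination by a point mass *)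

Section point_mass.
Context {R : realType} {p : nat} (eps r : R) (i0 i1 : 'I_p).
Hypotheses (eps0 : 0 <= eps) (eps1 : eps < 1 / 3) (i01 : i1 != i0).

Definition axis_point : p.-tuple R := [tuple if i == i0 then r else 0 | i < p].

Lemma dotp_axis_point u : dotp u axis_point = u i0 0 * r.
Proof.
rewrite /dotp (bigD1 i0)//= tnth_mktuple eqxx big1 ?addr0// => i /negbTE ii0.
by rewrite tnth_mktuple ii0 mulr0.
Qed.

Variable P : probability (p.-tuple R) R.
Hypothesis PE : forall A, measurable A ->
  P A = ((1 - eps)%:E * std_normal p A + eps%:E * \d_axis_point A)%E.

Lemma point_mass_law_le u q : usphere u -> 0 < q ->
  P [set x | `|dotp u x| ^+ 2 <= q] = ((1 - eps) * (2 * Phi (Num.sqrt q) - 1) +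
    eps * (u i0 0 ^+ 2 * r ^+ 2 <= q)%R%:R)%:E.
Proof.
move=> u1 q0; rewrite PE; last exact: measurable_sqdotp_le.
rewrite sqdotp_law_le// diracE -EFinM -EFinM -EFinD.
congr ((_ + eps * _%:R)%:E); congr nat_of_bool.
apply/idP/idP; rewrite inE /= dotp_axis_point real_normK ?num_real// exprMn//.
Qed.

Lemma point_mass_law_ge u q : usphere u -> 0 < q ->
  P [set x | `|dotp u x| ^+ 2 >= q] = ((1 - eps) * (2 - 2 * Phi (Num.sqrt q)) +
    eps * (q <= u i0 0 ^+ 2 * r ^+ 2)%R%:R)%:E.
Proof.
move=> u1 q0; rewrite PE; last exact: measurable_sqdotp_ge.
rewrite sqdotp_law_ge// diracE -EFinM -EFinM -EFinD.
congr ((_ + eps * _%:R)%:E); congr nat_of_bool.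
apply/idP/idP; rewrite inE /= dotp_axis_point real_normK ?num_real// exprMn//.
Qed.

(** Contamination at a far point x of an axis creates a conflict between
    neighbouring directions. If the form of Gamma along that axis is at least r^2,
    the complement of the slab is too light, even with x in it. Otherwise turn
    from this axis towards another one: x is first outside and then inside the
    slab. Were the depth larger than (1 - eps) / 2, the slabs without x would have
    to be wider than some tau1 and the others narrower than some tau2 < tau1,
    which is impossible at the direction where x crosses the boundary. *)
Lemma point_mass_depth_le Gamma : spd Gamma -> max_scale eps ^+ 2 <= r ^+ 2 ->
  (scatter_depth Gamma P <= ((1 - eps) / 2)%:E)%E.
Proof.
move=> sG hir.
rewrite leNgt; apply/negP => D.
have e1 : 0 < 1 - eps by move: eps0 eps1; lra.
have [delta [delta1 delta2 Ddelta]] : exists delta : R,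
    [/\ (1 - eps) / 2 < delta, delta < 1 - eps &
        (delta%:E <= scatter_depth Gamma P)%E].
  (* delta is capped below 1 - eps so that the quantiles tau1 and tau2 exist. *)
  case: (scatter_depth Gamma P) D => [x| |//]; last first.
    by move=> _; exists (3 / 4 * (1 - eps)); split; [lra|lra|rewrite leey].
  rewrite lte_fin => D; exists (Num.min x (3 / 4 * (1 - eps))).
  rewrite lt_min D lee_fin gt_min ge_min lexx.
  by split => //; [lra|apply/orP; right; lra].
pose m := delta / (1 - eps).
have m1 : m < 1 by rewrite ltr_pdivrMr// mul1r.
have m2 : 1 / 2 < m by rewrite ltr_pdivlMr//; lra.
have dm : delta = (1 - eps) * m by rewrite /m mulrC divfK// gt_eqF.
(* Without the point mass, depth delta forces P0-probability m in a slab, hence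
   the scale tau1, and P0-probability m outside it, hence the scale tau2. *)
pose tau1 : R := Phi_inv ((1 + m) / 2).
pose tau2 : R := Phi_inv (1 - m / 2).
have t1 : 0 < tau1 by apply: Phi_inv_gt0; lra.
have t2 : 0 < tau2 by apply: Phi_inv_gt0; lra.
have P1 : Phi tau1 = (1 + m) / 2 by rewrite Phi_invK//; lra.
have P2 : Phi tau2 = 1 - m / 2 by rewrite Phi_invK//; lra.
have below u : usphere u -> qform Gamma u < u i0 0 ^+ 2 * r ^+ 2 ->
    tau1 ^+ 2 <= qform Gamma u.
  move=> u1 lt; have q0 := spd_gt0 sG u1.
  have [/(le_trans Ddelta) + _] := scatter_depth_le P Gamma u1.
  rewrite point_mass_law_le// (lt_geF lt) /= mulr0 addr0 lee_fin dm ler_pM2l//.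
  rewrite -(ler_sqrtE (ltW t1) (ltW q0)) -(Phi_le tau1) P1; lra.
have above u : usphere u -> u i0 0 ^+ 2 * r ^+ 2 < qform Gamma u ->
    qform Gamma u <= tau2 ^+ 2.
  move=> u1 lt; have q0 := spd_gt0 sG u1.
  have [_ /(le_trans Ddelta)] := scatter_depth_le P Gamma u1.
  rewrite point_mass_law_ge// (lt_geF lt) /= mulr0 addr0 lee_fin dm ler_pM2l//.
  rewrite -(sqrtr_leE (ltW t2) (ltW q0)) -(Phi_le _ tau2) P2; lra.
pose e (i : 'I_p) : 'cV[R]_p := delta_mx i 0.
have [Ar|rA] := ltP (qform Gamma (e i0)) (r ^+ 2); last first.
  have u1 : usphere (e i0) by exact: sqnorm_delta.
  have q0 := spd_gt0 sG u1.
  have [_ /(le_trans Ddelta)] := scatter_depth_le P Gamma u1.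
  rewrite point_mass_law_ge// lee_fin; set b := (_ <= _ * _)%R.
  have : eps * b%:R <= eps by case: b; rewrite ?mulr1 ?mulr0.
  have : Phi (max_scale eps) <= Phi (Num.sqrt (qform Gamma (e i0))).
    rewrite Phi_le (ler_sqrtE (ltW (max_scale_gt0 eps0 eps1)) (ltW q0)).
    exact: le_trans hir rA.
  rewrite -(ler_pM2l e1 (Phi _)); have := max_scaleE eps0 eps1; lra.
have C0 : 0 < qform Gamma (e i1).
  by apply: spd_gt0 => //; exact: sqnorm_delta.
suff : tau1 ^+ 2 <= tau2 ^+ 2.
  rewrite ler_pXn2r ?nnegrE ?(ltW t1) ?(ltW t2)// -(Phi_le tau1) P1 P2; lra.
have i10 : (i0 == i1) = false by rewrite eq_sym; exact: negbTE.
have v0 s : e i0 + s *: e i1 != 0.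
  apply/eqP => /colP /(_ i0) /eqP; rewrite !mxE !eqxx i10.
  by rewrite mulr0 addr0 oner_eq0.
have vi0 s : (e i0 + s *: e i1) i0 0 = 1.
  by rewrite !mxE !eqxx i10 mulr0 addr0.
have nv s : sqnorm (e i0 + s *: e i1) = 1 + s ^+ 2.
  rewrite /sqnorm (bigD1 i0)// (bigD1 i1)//= vi0 expr1n.
  rewrite big1 => [|j /andP[/negbTE j0 /negbTE j1]].
    by rewrite !mxE !eqxx (negbTE i01) /= mulr1 add0r addr0.
  by rewrite !mxE j0 j1 mulr0 addr0 expr0n.
(* Normalising e_{i0} + s e_{i1} divides the form and the squared projection of
   the point, r^2, by the same factor 1 + s^2. *)
have dir s : exists2 w, usphere w &
    qform Gamma (e i0 + s *: e i1) = (1 + s ^+ 2) * qform Gamma w /\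
    (1 + s ^+ 2) * w i0 0 ^+ 2 = 1.
  have [w w1 wE] := qform_sphere (v0 s); exists w => //.
  split; first by rewrite wE nv.
  by rewrite -(qform_delta i0 w) -nv -wE qform_delta vi0 expr1n.
have pos s : 0 < 1 + s ^+ 2 :> R by rewrite ltr_pwDl// sqr_ge0.
have line s := qform_line Gamma (e i0) (e i1) s.
set B := (_ + _ : R) in line.
apply: (@quadratic_crossing _ _ B _ _ _ _ C0 Ar) => s; rewrite -line;
  have [w w1 [-> wi0]] := dir s => lt.
- rewrite mulrC ler_pM2l//; apply: below => //.
  by rewrite -(ltr_pM2l (pos s)) mulrA wi0 mul1r.
- rewrite [leRHS]mulrC ler_pM2l//; apply: above => //.
  by rewrite -(ltr_pM2l (pos s)) mulrA wi0 mul1r.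
Qed.

End point_mass.

Section two_level.
Context {R : realType} {p : nat} (i0 : 'I_p) (x y : R).

Definition two_level_mx : 'M[R]_p := y%:M + (x - y) *: delta_mx i0 i0.

Lemma qform_two_level u :
  qform two_level_mx u = y * sqnorm u + (x - y) * u i0 0 ^+ 2.
Proof.
rewrite -qform_delta -qform_scalar /qform mulmxDr mulmxDl mxE; congr (_ + _).
by rewrite -scalemxAr -scalemxAl mxE.
Qed.

Lemma spd_two_level : 0 < y -> y <= x -> spd two_level_mx.
Proof.
move=> y0 yx; split.
  by rewrite /two_level_mx linearD linearZ /= tr_scalar_mx trmx_delta.
move=> u u0; rewrite qform_two_level ltr_pwDl//.
  by rewrite mulr_gt0// sqnorm_gt0.
by rewrite mulr_ge0 ?subr_ge0// sqr_ge0.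
Qed.

Lemma two_level_mul (i1 : 'I_p) : i1 != i0 ->
  two_level_mx *m delta_mx i1 0 = y *: (delta_mx i1 0 : 'cV_p).
Proof.
move=> i01; rewrite mulmxDl mul_scalar_mx -scalemxAl mul_delta_mx_0 1?eq_sym//.
by rewrite scaler0 addr0.
Qed.

End two_level.

Section extremal.
Context {R : realType} {p : nat} (eps : R) (i0 i1 : 'I_p).
Hypotheses (eps0 : 0 <= eps) (eps1 : eps < 1 / 3) (i01 : i1 != i0).

Definition extremal_mx : 'M[R]_p :=
  two_level_mx i0 (max_scale eps ^+ 2) (min_scale eps ^+ 2).

Let lo2 : 0 < min_scale eps ^+ 2. Proof. by rewrite exprn_gt0// min_scale_gt0. Qed.

Let lohi : min_scale eps ^+ 2 <= max_scale eps ^+ 2.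
Proof.
have l0 := min_scale_gt0 eps0 eps1; have h0 := max_scale_gt0 eps0 eps1.
rewrite ler_pXn2r ?nnegrE ?(ltW l0) ?(ltW h0)//.
by rewrite (le_trans (min_scale_le_base _ _))// base_scale_le_max.
Qed.

Lemma spd_extremal : spd extremal_mx.
Proof. exact: spd_two_level. Qed.

(** The squared base scale is a convex combination of the two extreme ones; the
    weight a is positive because [min_scale] is smaller than [base_scale] as soon
    as eps > 0. *)
Lemma crossing_weight : exists2 a : R, 0 < a <= 1 &
  @base_scale R ^+ 2 =
    min_scale eps ^+ 2 + (max_scale eps ^+ 2 - min_scale eps ^+ 2) * a.
Proof.
have [->|en0] := eqVneq eps 0.
  by exists 1; rewrite ?max_scale0 ?min_scale0 ?subrr ?mul0r ?addr0// ltr01 lexx.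
have e0 : 0 < eps by rewrite lt_neqAle eq_sym en0.
have l0 := min_scale_gt0 eps0 eps1; have h0 := max_scale_gt0 eps0 eps1.
have m0 := @base_scale_gt0 R.
have lm : min_scale eps ^+ 2 < @base_scale R ^+ 2.
  by rewrite ltr_pXn2r ?nnegrE ?(ltW l0) ?(ltW m0)// min_scale_lt_base.
have mh : @base_scale R ^+ 2 <= max_scale eps ^+ 2.
  by rewrite ler_pXn2r ?nnegrE ?(ltW h0) ?(ltW m0)// base_scale_le_max.
have d0 : 0 < max_scale eps ^+ 2 - min_scale eps ^+ 2.
  by rewrite subr_gt0 (lt_le_trans lm).
exists ((@base_scale R ^+ 2 - min_scale eps ^+ 2) /
  (max_scale eps ^+ 2 - min_scale eps ^+ 2)).
  by rewrite ler_pdivrMr// mul1r lerD2r mh andbT divr_gt0// subr_gt0.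
by rewrite mulrC divfK ?gt_eqF// addrC subrK.
Qed.

(** In a direction u with w = u_{i0}^2, the extremal form is
    t = min^2 + (max^2 - min^2) w and the squared projection of the contaminating
    point is base^2 w / a. The choice of a makes both equal to base^2 at w = a, so
    that t - base^2 w / a = min^2 (1 - w / a). Hence for w <= a the point lies in
    the slab, where it makes up for a scale t below base^2, and for w >= a it
    lies outside, where it makes up for a scale above base^2: the depth is at least
    (1 - eps) / 2, the best possible value by [point_mass_depth_le]. *)
Lemma extremal_deepest (a : R) (P : probability (p.-tuple R) R) :
  0 < a <= 1 ->
  @base_scale R ^+ 2 =
    min_scale eps ^+ 2 + (max_scale eps ^+ 2 - min_scale eps ^+ 2) * a ->
  (forall A, measurable A -> P A = ((1 - eps)%:E * std_normal p A +
     eps%:E * \d_(axis_point (@base_scale R / Num.sqrt a) i0) A)%E) ->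
  deepest P extremal_mx.
Proof.
move=> /andP[a0 a1] aE PE; split; first exact: spd_extremal.
have m0 := @base_scale_gt0 R.
have r2 : (@base_scale R / Num.sqrt a) ^+ 2 = @base_scale R ^+ 2 / a.
  by rewrite expr_div_n sqr_sqrtr// ltW.
have depthG : (((1 - eps) / 2)%:E <= scatter_depth extremal_mx P)%E.
  apply: le_scatter_depth => u u1; have t0 := spd_gt0 spd_extremal u1.
  rewrite (point_mass_law_le PE u1 t0) (point_mass_law_ge PE u1 t0) r2 !lee_fin.
  have tE : qform extremal_mx u =
      min_scale eps ^+ 2 + (max_scale eps ^+ 2 - min_scale eps ^+ 2) * u i0 0 ^+ 2.
    by rewrite qform_two_level [sqnorm u]u1 mulr1.
  have w0 : 0 <= u i0 0 ^+ 2 := sqr_ge0 _.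
  have w1 : u i0 0 ^+ 2 <= 1.
    by rewrite -u1 (bigD1 i0)//= lerDl sumr_ge0// => i _; rewrite sqr_ge0.
  set t := qform _ u in t0 tE *; set w := u i0 0 ^+ 2 in w0 w1 tE *.
  have dd : 0 <= max_scale eps ^+ 2 - min_scale eps ^+ 2 by rewrite subr_ge0.
  have t_lo : min_scale eps ^+ 2 <= t by rewrite tE lerDl mulr_ge0.
  have t_hi : t <= max_scale eps ^+ 2.
    by rewrite tE -lerBrDl -[leRHS]mulr1 ler_wpM2l.
  have e1 : 0 < 1 - eps by move: eps1; lra.
  have gapE : t - w * (@base_scale R ^+ 2 / a) = min_scale eps ^+ 2 * (1 - w / a).
    by rewrite tE aE; field; rewrite gt_eqF.
  have Phi_t_min : Phi (min_scale eps) <= Phi (Num.sqrt t).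
    by rewrite Phi_le (ler_sqrtE (ltW (min_scale_gt0 eps0 eps1)) (ltW t0)).
  have Phi_t_max : Phi (Num.sqrt t) <= Phi (max_scale eps).
    by rewrite Phi_le (sqrtr_leE (ltW (max_scale_gt0 eps0 eps1)) (ltW t0)).
  have lE := min_scaleE eps0 eps1; have hE := max_scaleE eps0 eps1.
  rewrite -(ler_pM2l e1) in Phi_t_min; rewrite -(ler_pM2l e1) in Phi_t_max.
  have nn (b : bool) : 0 <= eps * b%:R by rewrite mulr_ge0.
  have [wa|/ltW aw] := leP w a.
    have -> : (w * (@base_scale R ^+ 2 / a) <= t)%R.
      by rewrite -subr_ge0 gapE mulr_ge0 ?(ltW lo2)// subr_ge0 ler_pdivrMr// mul1r.
    have : Phi (Num.sqrt t) <= Phi (@base_scale R).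
      rewrite Phi_le (sqrtr_leE (ltW m0) (ltW t0)) tE aE lerD2l.
      by rewrite ler_wpM2l.
    rewrite Phi_base_scale -(ler_pM2l e1 (Phi _)) mulr1.
    have := nn (t <= w * (@base_scale R ^+ 2 / a)).
    by split; lra.
  have -> : (t <= w * (@base_scale R ^+ 2 / a))%R.
    rewrite -subr_le0 gapE pmulr_rle0// subr_le0 ler_pdivlMr// mul1r//.
  have : Phi (@base_scale R) <= Phi (Num.sqrt t).
    rewrite Phi_le (ler_sqrtE (ltW m0) (ltW t0)) tE aE lerD2l.
    by rewrite ler_wpM2l.
  rewrite Phi_base_scale -(ler_pM2l e1 (3 / 4)) mulr1.
  have := nn (w * (@base_scale R ^+ 2 / a) <= t).
  by split; lra.
move=> G' sG'; apply: le_trans depthG; apply: (point_mass_depth_le _ _ i01 PE) => //.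
rewrite r2 ler_pdivlMr// aE mulrBl addrCA lerDl subr_ge0.
by rewrite ler_piMr ?(ltW lo2).
Qed.

End extremal.

(** * The two maximum biases *)

Section bias.
Context {R : realType} {p : nat} (eps : R) (i0 i1 : 'I_p).
Hypotheses (eps0 : 0 <= eps) (eps1 : eps < 1 / 3) (i01 : i1 != i0).

Let med2 : 0 < @base_scale R ^+ 2. Proof. by rewrite exprn_gt0// base_scale_gt0. Qed.
Let lo2 : 0 < min_scale eps ^+ 2. Proof. by rewrite exprn_gt0// min_scale_gt0. Qed.

Lemma base_scale_deepest : deepest (@std_normal R p) (@base_scale R ^+ 2)%:M.
Proof.
have -> : (@base_scale R ^+ 2)%:M = extremal_mx 0 i0.
  by rewrite /extremal_mx /two_level_mx max_scale0 min_scale0 subrr scale0r addr0.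
apply: (@extremal_deepest _ _ _ _ _ (lexx 0) _ i01 1); first by lra.
- by rewrite ltr01 lexx.
- by rewrite max_scale0 min_scale0 subrr mul0r addr0.
- by move=> A _; rewrite subr0 mul1e mul0e adde0.
Qed.

(** One contaminated law serves both biases: its deepest matrix reaches
    [max_scale] along i0 and [min_scale] along all other axes. *)
Lemma extremal_contamination : exists2 P : probability (p.-tuple R) R,
  contamination eps (std_normal p) P & deepest P (extremal_mx eps i0).
Proof.
have eps_le1 : eps <= 1 by move: eps1; lra.
have [a a01 aE] := crossing_weight eps0 eps1.
pose Q : probability (p.-tuple R) R :=
  \d_(axis_point (@base_scale R / Num.sqrt a) i0).
pose P : probability (p.-tuple R) R := mixture (std_normal p) Q eps0 eps_le1.
have PE A : P A = ((1 - eps)%:E * std_normal p A + eps%:E * Q A)%E.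
  exact: mixtureE.
exists P; first by exists Q.
by apply: (extremal_deepest eps0 eps1 i01 a01 aE) => A _; exact: PE.
Qed.

Let e_sphere (i : 'I_p) : usphere (delta_mx i 0 : 'cV[R]_p).
Proof. exact: sqnorm_delta. Qed.

Lemma explosion_biasE :
  explosion_bias (@deepest R p) eps (std_normal p) =
  (max_scale eps ^+ 2 / @base_scale R ^+ 2)%:E.
Proof.
apply/eqP; rewrite eq_le; apply/andP; split.
  apply: ge_ereal_sup => _ [P [G [G0 [cP dG dG0 ->]]]].
  apply: ge_ereal_sup => _ [u u1 <-].
  rewrite (deepest_std_normal dG0) qform_scalar [sqnorm u]u1 mulr1 lee_fin.
  have /andP[_ hG] := deepest_bounds eps0 eps1 cP dG u1.
  by rewrite ler_pM2r// invr_gt0.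
have [P cP dP] := extremal_contamination.
apply: le_ereal_sup_tmp; eexists.
  exists P, (extremal_mx eps i0), (@base_scale R ^+ 2)%:M; split => //.
  exact: base_scale_deepest.
apply: le_ereal_sup_tmp; eexists; first by exists (delta_mx i0 0).
rewrite qform_scalar sqnorm_delta mulr1 lee_fin qform_two_level sqnorm_delta.
by rewrite mxE !eqxx expr1n !mulr1 addrC subrK.
Qed.

Lemma implosion_biasE :
  implosion_bias (@deepest R p) eps (std_normal p) =
  (@base_scale R ^+ 2 / min_scale eps ^+ 2)%:E.
Proof.
have base_inv u : usphere u ->
    qform (invmx (@base_scale R ^+ 2)%:M) u = (@base_scale R ^+ 2)^-1.
  by move=> u1; rewrite invmx_scalar qform_scalar [sqnorm u]u1 mulr1.
apply/eqP; rewrite eq_le; apply/andP; split.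
  apply: ge_ereal_sup => _ [P [G [G0 [cP dG dG0 ->]]]].
  apply: ge_ereal_sup => _ [u u1 <-].
  rewrite (deepest_std_normal dG0) base_inv// invrK lee_fin mulrC ler_pM2l//.
  apply: qform_invmx_le => //; first by have [] := dG.
  by move=> v /(deepest_bounds eps0 eps1 cP dG)/andP[].
have [P cP dP] := extremal_contamination.
apply: le_ereal_sup_tmp; eexists.
  exists P, (extremal_mx eps i0), (@base_scale R ^+ 2)%:M; split => //.
  exact: base_scale_deepest.
apply: le_ereal_sup_tmp; eexists; first by exists (delta_mx i1 0).
rewrite base_inv// invrK lee_fin.
rewrite (@qform_invmx_eigen _ _ _ _ (min_scale eps ^+ 2)) ?gt_eqF// 1?mulrC//.
  by apply: spd_unitmx; exact: spd_extremal.
exact: two_level_mul.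
Qed.

End bias.

Theorem theorem2 (R : realType) (p : nat) (eps : R)
  (p_ge2 : (2 <= p)%N) (eps_ge0 : 0 <= eps) (eps_lt : eps < 1 / 3) :
  let P0 : probability (p.-tuple R) R := std_normal p in
  let beta : R := Phi_inv (3 / 4) ^+ 2 in
  maximum_bias (@deepest R p) eps P0 =
  ((Num.max
      (1 / Num.sqrt beta * Phi_inv ((3 - eps) / (4 * (1 - eps))))
      (Num.sqrt beta / Phi_inv ((3 - 5 * eps) / (4 * (1 - eps))))) ^+ 2)%:E.
Proof.
pose i0 := Ordinal (ltnW p_ge2); pose i1 := Ordinal p_ge2.
have i01 : i1 != i0 by [].
move=> P0 beta; rewrite /maximum_bias (explosion_biasE eps_ge0 eps_lt i01).
rewrite (implosion_biasE eps_ge0 eps_lt i01).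
have m0 := @base_scale_gt0 R; have l0 := min_scale_gt0 eps_ge0 eps_lt.
have h0 := max_scale_gt0 eps_ge0 eps_lt.
have -> : Num.sqrt beta = @base_scale R by rewrite sqrtr_sqr gtr0_norm.
rewrite div1r [_^-1 * _]mulrC -!/(max_scale _) -!/(min_scale _).
have x0 : 0 <= max_scale eps / @base_scale R by rewrite divr_ge0// ltW.
have y0 : 0 <= @base_scale R / min_scale eps by rewrite divr_ge0// ltW.
rewrite -!expr_div_n -EFin_max; congr EFin.
have [xy|/ltW yx] :=
  leP (max_scale eps / @base_scale R) (@base_scale R / min_scale eps).
  by apply: max_r; rewrite ler_pXn2r.
by apply: max_l; rewrite ler_pXn2r.
Qed.
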